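(* Let $k$ be a field, $\mathsf{C}$ a $k$-linear abelian category, and suppose $\underline{\mathcal{L}}=(\mathcal{L}_i)_{i\in\mathbb{Z}}$ is a helix in $\mathsf{C}$. Then (1) for all $i\in\mathbb{Z}$, the $\mathbb{Z}$-algebra $\mathbb{S}^{nc}(\operatorname{Hom}(\mathcal{L}_i,\mathcal{L}_{i+1}))$ exists (i.e. the bimodule $\operatorname{Hom}(\mathcal{L}_i,\mathcal{L}_{i+1})$ is admissible), and (2) there is an isomorphism of $\mathbb{Z}$-algebras $$\mathbb{S}^{nc}(\operatorname{Hom}(\mathcal{L}_{-1},\mathcal{L}_0))\longrightarrow\mathbb{S}^{nc}(\underline{\mathcal{L}}).$$
   Context: **$\mathbb{Z}$-algebras.** A $\mathbb{Z}$-algebra over $k$ is a ring $A=\bigoplus_{i,j\in\mathbb{Z}}A_{ij}$ (of $k$-vector spaces) with $A_{ij}A_{jl}\subseteq A_{il}$, $A_{ij}A_{ml}=0$ for $j\neq m$, and local units $e_i\in A_{ii}$. Write $D_i=\operatorname{End}\mathcal{L}_i$. **Noncommutative symmetric algebra of a sequence.** $\mathbb{S}^{nc}(\underline{\mathcal{L}})$ is the $\mathbb{Z}$-algebra with $(i,i)$-component $D_{-i}$, generated by the $D_{i+1}$-$D_i$-bimodules $\operatorname{Hom}(\mathcal{L}_i,\mathcal{L}_{i+1})$ in its $(-(i+1),-i)$-component, with relations generated by the kernels of the compositions $\operatorname{Hom}(\mathcal{L}_{i+1},\mathcal{L}_{i+2})\otimes_{D_{i+1}}\operatorname{Hom}(\mathcal{L}_i,\mathcal{L}_{i+1})\to\operatorname{Hom}(\mathcal{L}_i,\mathcal{L}_{i+2})$.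 **Noncommutative symmetric algebra of a bimodule.** Let $K_0,K_1$ be division rings over $k$ and $M$ a $K_0$-$K_1$-bimodule. For an $R$-$S$-bimodule $N$, its right dual is the $S$-$R$-bimodule $N^*=\operatorname{Hom}_S(N_S,S_S)$ and its left dual is the $S$-$R$-bimodule ${}^*N=\operatorname{Hom}_R({}_RN,{}_RR)$. Put $M^{0*}=M$, $M^{(i+1)*}=(M^{i*})^*$ for $i\ge0$, and $M^{(i-1)*}={}^*(M^{i*})$ for $i\le0$. $M$ is admissible if all $M^{i*}$ ($i\in\mathbb{Z}$) are finite-dimensional on both sides; then $M^{(i+1)*}\cong(M^{i*})^*$ canonically for all $i$. Let $K_i=K_0$ for $i$ even, $K_i=K_1$ for $i$ odd, and let $Q_i\subseteq M^{i*}\otimes_{K_{i+1}}M^{(i+1)*}$ be the image of the unit map $K_i\to M^{i*}\otimes M^{(i+1)*}$, $1\mapsto\sum_jm_j\otimes m_j^*$ (dual bases). For $M$ admissible, $\mathbb{S}^{nc}(M)$ is the $\mathbb{Z}$-algebra with $(i,i)$-component $K_i$, generated by $M^{i*}$ in its $(i,i+1)$-component, with relations generated by the $Q_i$ in the $(i,i+2)$-components. Here $\operatorname{Hom}(\mathcal{L}_i,\mathcal{L}_{i+1})$ is a $D_{i+1}$-$D_i$-bimodule. **Helix.** If $D=\operatorname{End}\mathcal{L}$ is a division ring and $H=\operatorname{Hom}(\mathcal{M},\mathcal{L})$ is a finite-dimensional left $D$-space, put ${}^*H=\operatorname{Hom}_D(H,D)$; with a left basis $f_1,\dots,f_n$ of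 $H$, the object ${}^*H\otimes_D\mathcal{L}$ is $\mathcal{L}^n$ and the canonical map $\eta_{\mathcal{M}}:\mathcal{M}\to{}^*H\otimes_D\mathcal{L}$ is $(f_1,\dots,f_n)$. $\underline{\mathcal{L}}$ is a helix if for all $i$: (1) $D_i$ is a division ring with $k$ in its center; (2) $\operatorname{Hom}(\mathcal{L}_i,\mathcal{L}_{i+1})$ is finite-dimensional as a left $D_{i+1}$-module and as a right $D_i$-module; (3) there is a short exact sequence (the $i$th Euler sequence) $0\to\mathcal{L}_i\xrightarrow{\eta_{\mathcal{L}_i}}{}^*\operatorname{Hom}(\mathcal{L}_i,\mathcal{L}_{i+1})\otimes_{D_{i+1}}\mathcal{L}_{i+1}\to\mathcal{L}_{i+2}\to0$; (4) the canonical injective $k$-algebra map $\Phi_i:D_i\to D_{i+2}$ (an endomorphism of $\mathcal{L}_i$ acts by functoriality on the middle term of the $i$th Euler sequence compatibly with $\eta_{\mathcal{L}_i}$, hence on the cokernel $\mathcal{L}_{i+2}$) is an isomorphism; (5) giving $\operatorname{Hom}(\mathcal{L}_{i+1},\mathcal{L}_{i+2})$ the $D_i$-$D_{i+1}$-bimodule structure via $\Phi_i$, the canonical map ${}^*\operatorname{Hom}(\mathcal{L}_i,\mathcal{L}_{i+1})\to\operatorname{Hom}(\mathcal{L}_{i+1},\mathcal{L}_{i+2})$ obtained by applying $\operatorname{Hom}(\mathcal{L}_{i+1},-)$ to the $i$th Euler sequence is an isomorphism of bimodules. *)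

(* Defs.v *)
From HB Require Import structures.
From mathcomp Require Import all_boot all_algebra.
From mathcomp Require Import boolp.

Set Implicit Arguments.
Unset Strict Implicit.
Unset Printing Implicit Defensive.

Import GRing.Theory.
Local Open Scope ring_scope.

(* A ring with a central morphism from k. MathComp's [algType] excludes the zero
   ring, whereas the endomorphism ring of an object may a priori be zero. *)
Record kalg (k : fieldType) := KAlg {
  kring :> pzRingType;
  kin : {rmorphism k -> kring};
  kinC : forall (c : k) (x : kring), kin c * x = x * kin c;
}.
Arguments kin {k} A : rename.

Definition division_ring (R : pzRingType) : Prop :=
  1 <> 0 :> R /\ forall x : R, x <> 0 -> exists y, y * x = 1 /\ x * y = 1.

Record bimod (k : fieldType) (R S : kalg k) := Bimod {
  bcar :> zmodType;
  lact : R -> bcar -> bcar;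
  ract : bcar -> S -> bcar;
  lactDl : forall a b x, lact (a + b) x = lact a x + lact b x;
  lactDr : forall a x y, lact a (x + y) = lact a x + lact a y;
  lactA : forall a b x, lact a (lact b x) = lact (a * b) x;
  lact1 : forall x, lact 1 x = x;
  ractDl : forall x y b, ract (x + y) b = ract x b + ract y b;
  ractDr : forall x a b, ract x (a + b) = ract x a + ract x b;
  ractA : forall x a b, ract (ract x a) b = ract x (a * b);
  ract1 : forall x, ract x 1 = x;
  lractA : forall a x b, lact a (ract x b) = ract (lact a x) b;
  lractk : forall (c : k) x, lact (kin R c) x = ract x (kin S c);
}.

Definition left_basis (k : fieldType) (R S : kalg k) (N : bimod R S)
    (n : nat) (b : 'I_n -> N) : Prop :=
  (forall c : 'I_n -> R, \sum_j lact (c j) (b j) = 0 -> forall j, c j = 0) /\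
  (forall x : N, exists c : 'I_n -> R, x = \sum_j lact (c j) (b j)).

Definition right_basis (k : fieldType) (R S : kalg k) (N : bimod R S)
    (n : nat) (b : 'I_n -> N) : Prop :=
  (forall c : 'I_n -> S, \sum_j ract (b j) (c j) = 0 -> forall j, c j = 0) /\
  (forall x : N, exists c : 'I_n -> S, x = \sum_j ract (b j) (c j)).

Definition left_findim (k : fieldType) (R S : kalg k) (N : bimod R S) :=
  exists (n : nat) (b : 'I_n -> N), left_basis b.

Definition right_findim (k : fieldType) (R S : kalg k) (N : bimod R S) :=
  exists (n : nat) (b : 'I_n -> N), right_basis b.

Definition bimod_iso (k : fieldType) (R S : kalg k) (N P : bimod R S)
    (f : N -> P) : Prop :=
  [/\ forall x y, f (x + y) = f x + f y,
      forall a x, f (lact a x) = lact a (f x),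
      forall x b, f (ract x b) = ract (f x) b
    & bijective f].

Section RestrictScalars.
Variables (k : fieldType) (R' R S : kalg k) (f : {rmorphism R' -> R}).
Hypothesis fk : forall c : k, f (kin R' c) = kin R c.
Variable N : bimod R S.

Let rlact (a : R') (x : N) : N := lact (f a) x.

Definition lrestrict : bimod R' S.
Proof.
refine (@Bimod k R' S N rlact (@ract k R S N) _ _ _ _ _ _ _ _ _ _);
  rewrite /rlact.
- by move=> a b x; rewrite rmorphD lactDl.
- by move=> a x y; rewrite lactDr.
- by move=> a b x; rewrite rmorphM lactA.
- by move=> x; rewrite rmorph1 lact1.
- exact: ractDl.
- exact: ractDr.
- exact: ractA.
- exact: ract1.
- by move=> a x b; rewrite lractA.
- by move=> c x; rewrite fk lractk.
Defined.

End RestrictScalars.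

Section LeftDual.
Variables (k : fieldType) (R S : kalg k) (N : bimod R S).

Record ldual_type := LDual {
  ldual_fun :> N -> R;
  ldualD : forall x y, ldual_fun (x + y) = ldual_fun x + ldual_fun y;
  ldualZ : forall a x, ldual_fun (lact a x) = a * ldual_fun x;
}.

HB.instance Definition _ := gen_eqMixin ldual_type.
HB.instance Definition _ := gen_choiceMixin ldual_type.

Lemma ldualP (f g : ldual_type) : f =1 g -> f = g.
Proof.
case: f g => [f fD fZ] [g gD gZ] /= /funext fg; subst g.
by congr LDual; apply: Prop_irrelevance.
Qed.

Let dzero : ldual_type.
Proof. by exists (fun=> 0) => *; rewrite ?addr0 ?mulr0. Defined.

Let dopp (f : ldual_type) : ldual_type.
Proof.
by exists (fun x => - f x) => *; rewrite ?ldualD ?ldualZ ?opprD ?mulrN.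
Defined.

Let dadd (f g : ldual_type) : ldual_type.
Proof.
exists (fun x => f x + g x) => *; last by rewrite !ldualZ mulrDr.
by rewrite !ldualD addrACA.
Defined.

Let daddA : associative dadd.
Proof. by move=> f g h; apply: ldualP => x /=; rewrite addrA. Qed.
Let daddC : commutative dadd.
Proof. by move=> f g; apply: ldualP => x /=; rewrite addrC. Qed.
Let dadd0 : left_id dzero dadd.
Proof. by move=> f; apply: ldualP => x /=; rewrite add0r. Qed.
Let daddN : left_inverse dzero dopp dadd.
Proof. by move=> f; apply: ldualP => x /=; rewrite addNr. Qed.

HB.instance Definition _ := GRing.isZmodule.Build ldual_type
  daddA daddC dadd0 daddN.

(* (s f r)(x) = f (x s) r *)
Definition ldual_lact (s : S) (f : ldual_type) : ldual_type.
Proof.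
exists (fun x => f (ract x s)) => *; first by rewrite ractDl ldualD.
by rewrite -lractA ldualZ.
Defined.

Definition ldual_ract (f : ldual_type) (r : R) : ldual_type.
Proof.
exists (fun x => f x * r) => *; first by rewrite ldualD mulrDl.
by rewrite ldualZ mulrA.
Defined.

Definition ldual : bimod S R.
Proof.
refine (@Bimod k S R ldual_type ldual_lact ldual_ract _ _ _ _ _ _ _ _ _ _).
- by move=> a b f; apply: ldualP => x /=; rewrite ractDr ldualD.
- by move=> a f g; apply: ldualP.
- by move=> a b f; apply: ldualP => x /=; rewrite ractA.
- by move=> f; apply: ldualP => x /=; rewrite ract1.
- by move=> f g b; apply: ldualP => x /=; rewrite mulrDl.
- by move=> f a b; apply: ldualP => x /=; rewrite mulrDr.
- by move=> f a b; apply: ldualP => x /=; rewrite mulrA.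
- by move=> f; apply: ldualP => x /=; rewrite mulr1.
- by move=> a f b; apply: ldualP.
- by move=> c f; apply: ldualP => x /=; rewrite -lractk ldualZ kinC.
Defined.

End LeftDual.

Section RightDual.
Variables (k : fieldType) (R S : kalg k) (N : bimod R S).

Record rdual_type := RDual {
  rdual_fun :> N -> S;
  rdualD : forall x y, rdual_fun (x + y) = rdual_fun x + rdual_fun y;
  rdualZ : forall x b, rdual_fun (ract x b) = rdual_fun x * b;
}.

HB.instance Definition _ := gen_eqMixin rdual_type.
HB.instance Definition _ := gen_choiceMixin rdual_type.

Lemma rdualP (f g : rdual_type) : f =1 g -> f = g.
Proof.
case: f g => [f fD fZ] [g gD gZ] /= /funext fg; subst g.
by congr RDual; apply: Prop_irrelevance.
Qed.

Let dzero : rdual_type.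
Proof. by exists (fun=> 0) => *; rewrite ?addr0 ?mul0r. Defined.

Let dopp (f : rdual_type) : rdual_type.
Proof.
by exists (fun x => - f x) => *; rewrite ?rdualD ?rdualZ ?opprD ?mulNr.
Defined.

Let dadd (f g : rdual_type) : rdual_type.
Proof.
exists (fun x => f x + g x) => *; last by rewrite !rdualZ mulrDl.
by rewrite !rdualD addrACA.
Defined.

Let daddA : associative dadd.
Proof. by move=> f g h; apply: rdualP => x /=; rewrite addrA. Qed.
Let daddC : commutative dadd.
Proof. by move=> f g; apply: rdualP => x /=; rewrite addrC. Qed.
Let dadd0 : left_id dzero dadd.
Proof. by move=> f; apply: rdualP => x /=; rewrite add0r. Qed.
Let daddN : left_inverse dzero dopp dadd.
Proof. by move=> f; apply: rdualP => x /=; rewrite addNr. Qed.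

HB.instance Definition _ := GRing.isZmodule.Build rdual_type
  daddA daddC dadd0 daddN.

(* (s f r)(x) = s f (r x) *)
Definition rdual_lact (s : S) (f : rdual_type) : rdual_type.
Proof.
exists (fun x => s * f x) => *; first by rewrite rdualD mulrDr.
by rewrite rdualZ mulrA.
Defined.

Definition rdual_ract (f : rdual_type) (r : R) : rdual_type.
Proof.
exists (fun x => f (lact r x)) => *; first by rewrite lactDr rdualD.
by rewrite lractA rdualZ.
Defined.

Definition rdual : bimod S R.
Proof.
refine (@Bimod k S R rdual_type rdual_lact rdual_ract _ _ _ _ _ _ _ _ _ _).
- by move=> a b f; apply: rdualP => x /=; rewrite mulrDl.
- by move=> a f g; apply: rdualP => x /=; rewrite mulrDr.
- by move=> a b f; apply: rdualP => x /=; rewrite mulrA.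
- by move=> f; apply: rdualP => x /=; rewrite mul1r.
- by move=> f g b; apply: rdualP.
- by move=> f a b; apply: rdualP => x /=; rewrite lactDl rdualD.
- by move=> f a b; apply: rdualP => x /=; rewrite lactA.
- by move=> f; apply: rdualP => x /=; rewrite lact1.
- by move=> a f b; apply: rdualP.
- by move=> c f; apply: rdualP => x /=; rewrite lractk rdualZ kinC.
Defined.

End RightDual.

(* The successor on [int], by cases so that it reduces on constructors; this
   makes the indices of the families below match definitionally. *)
Definition succz (i : int) : int :=
  match i with
  | Posz n => Posz n.+1
  | Negz 0 => Posz 0
  | Negz n.+1 => Negz n
  end.

Lemma succzE i : succz i = i + 1.
Proof.
case: i => [n|[|n]] //=; first by rewrite -PoszD addn1.
by rewrite !NegzE -[n.+2]addn1 PoszD opprD addrNK.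
Qed.

(* K0, K1, K0, K1, ..., with [Kseq K0 K1 n.+2] convertible to [Kseq K0 K1 n]. *)
Fixpoint Kseq (k : fieldType) (K0 K1 : kalg k) (n : nat) : kalg k :=
  if n is n'.+1 then Kseq K1 K0 n' else K0.

Definition Kz (k : fieldType) (K0 K1 : kalg k) (i : int) : kalg k :=
  Kseq K0 K1 `|i|%N.

Section IteratedDuals.
Variables (k : fieldType) (K0 K1 : kalg k) (M : bimod K0 K1).

Fixpoint rdualn (n : nat) : bimod (Kseq K0 K1 n) (Kseq K0 K1 n.+1) :=
  if n is n'.+1 then rdual (rdualn n') else M.

(* M^{(-n)*}, a K_{-n}-K_{-n+1}-bimodule; the indices below are modulo 2. *)
Fixpoint ldualn (n : nat) : bimod (Kseq K0 K1 n) (Kseq K0 K1 n.+1) :=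
  if n is n'.+1 then ldual (ldualn n') else M.

Definition dualz (i : int) : bimod (Kz K0 K1 i) (Kz K0 K1 (succz i)) :=
  match i with
  | Posz n => rdualn n
  | Negz 0 => ldualn 1
  | Negz n.+1 => ldualn n.+2
  end.

Definition admissible : Prop :=
  forall i : int, left_findim (dualz i) /\ right_findim (dualz i).

(* The evaluation pairing of M^{(i+1)*} = (M^{i*})^* with M^{i*}. For i < 0
   this identification is the canonical one, x |-> (phi |-> phi x), since
   there M^{i*} is the left dual of M^{(i+1)*}. *)
Definition dual_pairing (i : int) :
    dualz (succz i) -> dualz i -> Kz K0 K1 (succz i) :=
  match i with
  | Posz n => fun f x => rdual_fun f x
  | Negz 0 => fun x f => ldual_fun f x
  | Negz n.+1 =>
      match n return dualz (Negz n) -> dualz (Negz n.+1) -> Kz K0 K1 (Negz n)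
      with
      | 0 => fun x f => ldual_fun f x
      | n'.+1 => fun x f => ldual_fun f x
      end
  end.

End IteratedDuals.

(* A Z-algebra is given by its components A_{ij}; the products A_{ij} A_{ml}
   with j <> m, which vanish, are left implicit. *)
Record zalg (k : fieldType) := ZAlg {
  zcomp :> int -> int -> lmodType k;
  zmul : forall i j l, zcomp i j -> zcomp j l -> zcomp i l;
  zone : forall i, zcomp i i;
  zmulDl : forall i j l (x y : zcomp i j) (z : zcomp j l),
    zmul (x + y) z = zmul x z + zmul y z;
  zmulDr : forall i j l (x : zcomp i j) (y z : zcomp j l),
    zmul x (y + z) = zmul x y + zmul x z;
  zmulZl : forall i j l c (x : zcomp i j) (y : zcomp j l),
    zmul (c *: x) y = c *: zmul x y;
  zmulZr : forall i j l c (x : zcomp i j) (y : zcomp j l),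
    zmul x (c *: y) = c *: zmul x y;
  zmulA : forall i j l m (x : zcomp i j) (y : zcomp j l) (z : zcomp l m),
    zmul x (zmul y z) = zmul (zmul x y) z;
  zmul1l : forall i j (x : zcomp i j), zmul (zone i) x = x;
  zmul1r : forall i j (x : zcomp i j), zmul x (zone j) = x;
}.

Definition zalg_isomorphic (k : fieldType) (A B : zalg k) : Prop :=
  exists f : forall i j, {linear A i j -> B i j},
    [/\ forall i j, bijective (f i j),
        forall i, f i i (zone A i) = zone B i
      & forall i j l (x : A i j) (y : A j l),
          f i l (zmul x y) = zmul (f i j x) (f j l y)].

(* The list [:: (x1, y1); ...; (xn, yn)] stands for the element
   x1 (x) y1 + ... + xn (x) yn of M_i (x)_{K_(i+1)} M_(i+1). Which list
   represents a given tensor is immaterial: lists representing the same tensor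
   have the same image in the Z-algebra, whose product is balanced. *)
Record zpres (k : fieldType) := ZPres {
  presK : int -> kalg k;
  presM : forall i, bimod (presK i) (presK (succz i));
  presR : forall i, seq (presM i * presM (succz i)) -> Prop;
}.

Section Presented.
Variables (k : fieldType) (P : zpres k).

Inductive zterm : int -> int -> Type :=
  | Tconst i (a : presK P i) : zterm i i
  | Tgen i (m : presM P i) : zterm i (succz i)
  | Tzero i j : zterm i j
  | Topp i j (t : zterm i j) : zterm i j
  | Tadd i j (t u : zterm i j) : zterm i j
  | Tscale i j (c : k) (t : zterm i j) : zterm i j
  | Tmul i j l (t : zterm i j) (u : zterm j l) : zterm i l.

Definition Tquad i (s : seq (presM P i * presM P (succz i))) :
    zterm i (succz (succz i)) :=
  foldr (fun p t => Tadd (Tmul (Tgen p.1) (Tgen p.2)) t) (Tzero _ _) s.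

(* The smallest congruence for which the quotient is a Z-algebra, the maps
   K_i -> A_{ii} are morphisms of k-algebras, the maps M_i -> A_{i,i+1} are
   morphisms of bimodules, and the relations hold. *)
Inductive zcong : forall i j, zterm i j -> zterm i j -> Prop :=
  | Crefl i j (t : zterm i j) : zcong t t
  | Csym i j (t u : zterm i j) : zcong t u -> zcong u t
  | Ctrans i j (t u v : zterm i j) : zcong t u -> zcong u v -> zcong t v
  | Copp i j (t t' : zterm i j) : zcong t t' -> zcong (Topp t) (Topp t')
  | Cadd i j (t t' u u' : zterm i j) :
      zcong t t' -> zcong u u' -> zcong (Tadd t u) (Tadd t' u')
  | Cscale i j c (t t' : zterm i j) :
      zcong t t' -> zcong (Tscale c t) (Tscale c t')
  | Cmul i j l (t t' : zterm i j) (u u' : zterm j l) :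
      zcong t t' -> zcong u u' -> zcong (Tmul t u) (Tmul t' u')
  | CaddA i j (t u v : zterm i j) :
      zcong (Tadd t (Tadd u v)) (Tadd (Tadd t u) v)
  | CaddC i j (t u : zterm i j) : zcong (Tadd t u) (Tadd u t)
  | Cadd0 i j (t : zterm i j) : zcong (Tadd (Tzero i j) t) t
  | CaddN i j (t : zterm i j) : zcong (Tadd (Topp t) t) (Tzero i j)
  | CscaleA i j a b (t : zterm i j) :
      zcong (Tscale a (Tscale b t)) (Tscale (a * b) t)
  | Cscale1 i j (t : zterm i j) : zcong (Tscale 1 t) t
  | CscaleDr i j a (t u : zterm i j) :
      zcong (Tscale a (Tadd t u)) (Tadd (Tscale a t) (Tscale a u))
  | CscaleDl i j a b (t : zterm i j) :
      zcong (Tscale (a + b) t) (Tadd (Tscale a t) (Tscale b t))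
  | CmulDl i j l (t u : zterm i j) (v : zterm j l) :
      zcong (Tmul (Tadd t u) v) (Tadd (Tmul t v) (Tmul u v))
  | CmulDr i j l (t : zterm i j) (u v : zterm j l) :
      zcong (Tmul t (Tadd u v)) (Tadd (Tmul t u) (Tmul t v))
  | CmulZl i j l c (t : zterm i j) (u : zterm j l) :
      zcong (Tmul (Tscale c t) u) (Tscale c (Tmul t u))
  | CmulZr i j l c (t : zterm i j) (u : zterm j l) :
      zcong (Tmul t (Tscale c u)) (Tscale c (Tmul t u))
  | CmulA i j l m (t : zterm i j) (u : zterm j l) (v : zterm l m) :
      zcong (Tmul t (Tmul u v)) (Tmul (Tmul t u) v)
  | Cmul1l i j (t : zterm i j) : zcong (Tmul (Tconst 1) t) t
  | Cmul1r i j (t : zterm i j) : zcong (Tmul t (Tconst 1)) t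
  | CconstD i (a b : presK P i) :
      zcong (Tconst (a + b)) (Tadd (Tconst a) (Tconst b))
  | Cconstk i (c : k) :
      zcong (Tconst (kin (presK P i) c)) (Tscale c (Tconst 1))
  | CconstM i (a b : presK P i) :
      zcong (Tconst (a * b)) (Tmul (Tconst a) (Tconst b))
  | CgenD i (x y : presM P i) :
      zcong (Tgen (x + y)) (Tadd (Tgen x) (Tgen y))
  | Cgenl i a (x : presM P i) :
      zcong (Tgen (lact a x)) (Tmul (Tconst a) (Tgen x))
  | Cgenr i (x : presM P i) b :
      zcong (Tgen (ract x b)) (Tmul (Tgen x) (Tconst b))
  | Crel i (s : seq (presM P i * presM P (succz i))) :
      presR s -> zcong (Tquad s) (Tzero _ _).

HB.instance Definition _ i j := gen_eqMixin (zterm i j).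
HB.instance Definition _ i j := gen_choiceMixin (zterm i j).

Definition zcongb i j : rel (zterm i j) := fun t u => `[< zcong t u >].

Lemma zcongb_refl i j : reflexive (@zcongb i j).
Proof. by move=> t; apply/asboolP; apply: Crefl. Qed.

Lemma zcongb_sym i j : symmetric (@zcongb i j).
Proof. by move=> t u; apply/asboolP/asboolP; apply: Csym. Qed.

Lemma zcongb_trans i j : transitive (@zcongb i j).
Proof.
by move=> u t v /asboolP tu /asboolP uv; apply/asboolP; apply: Ctrans tu uv.
Qed.

Canonical zcong_equiv i j := EquivRel (@zcongb i j)
  (@zcongb_refl i j) (@zcongb_sym i j) (@zcongb_trans i j).

Definition zquot i j : Type := {eq_quot (@zcong_equiv i j)}%qT.

HB.instance Definition _ i j := Choice.on (zquot i j).

Definition zclass i j (t : zterm i j) : zquot i j :=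
  (\pi_({eq_quot (@zcong_equiv i j)}) t)%qT.

Definition zrepr i j (x : zquot i j) : zterm i j :=
  repr (x : {eq_quot (@zcong_equiv i j)}%qT).

Lemma zreprK i j (x : zquot i j) : zclass (zrepr x) = x.
Proof. exact: reprK. Qed.

Lemma zclassP i j (t u : zterm i j) : zclass t = zclass u <-> zcong t u.
Proof.
split=> [/eqP|tu]; first by rewrite eqmodE => /asboolP.
by apply/eqP; rewrite eqmodE; apply/asboolP.
Qed.

Lemma zrepr_class i j (t : zterm i j) : zcong (zrepr (zclass t)) t.
Proof. by apply/zclassP; rewrite zreprK. Qed.

Definition qadd i j (x y : zquot i j) := zclass (Tadd (zrepr x) (zrepr y)).
Definition qopp i j (x : zquot i j) := zclass (Topp (zrepr x)).
Definition qscale i j c (x : zquot i j) := zclass (Tscale c (zrepr x)).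
Definition qmul i j l (x : zquot i j) (y : zquot j l) :=
  zclass (Tmul (zrepr x) (zrepr y)).

Lemma qaddE i j (t u : zterm i j) :
  qadd (zclass t) (zclass u) = zclass (Tadd t u).
Proof. by apply/zclassP; apply: Cadd; apply: zrepr_class. Qed.

Lemma qoppE i j (t : zterm i j) : qopp (zclass t) = zclass (Topp t).
Proof. by apply/zclassP; apply: Copp; apply: zrepr_class. Qed.

Lemma qscaleE i j c (t : zterm i j) : qscale c (zclass t) = zclass (Tscale c t).
Proof. by apply/zclassP; apply: Cscale; apply: zrepr_class. Qed.

Lemma qmulE i j l (t : zterm i j) (u : zterm j l) :
  qmul (zclass t) (zclass u) = zclass (Tmul t u).
Proof. by apply/zclassP; apply: Cmul; apply: zrepr_class. Qed.

Let qaddA i j : associative (@qadd i j).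
Proof.
move=> x y z; rewrite -(zreprK x) -(zreprK y) -(zreprK z) !qaddE.
exact/zclassP/CaddA.
Qed.
Let qaddC i j : commutative (@qadd i j).
Proof.
by move=> x y; rewrite -(zreprK x) -(zreprK y) !qaddE; exact/zclassP/CaddC.
Qed.
Let qadd0 i j : left_id (zclass (Tzero i j)) (@qadd i j).
Proof. by move=> x; rewrite -(zreprK x) qaddE; exact/zclassP/Cadd0. Qed.
Let qaddN i j : left_inverse (zclass (Tzero i j)) (@qopp i j) (@qadd i j).
Proof. by move=> x; rewrite -(zreprK x) qoppE qaddE; exact/zclassP/CaddN. Qed.

HB.instance Definition _ i j := GRing.isZmodule.Build (zquot i j)
  (@qaddA i j) (@qaddC i j) (@qadd0 i j) (@qaddN i j).

Lemma zclassD i j (t u : zterm i j) :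
  zclass (Tadd t u) = zclass t + zclass u.
Proof. exact/esym/qaddE. Qed.

Let qscaleA i j a b (x : zquot i j) : qscale a (qscale b x) = qscale (a * b) x.
Proof. by rewrite -(zreprK x) !qscaleE; exact/zclassP/CscaleA. Qed.
Let qscale1 i j : left_id 1 (@qscale i j).
Proof. by move=> x; rewrite -(zreprK x) qscaleE; exact/zclassP/Cscale1. Qed.
Let qscaleDr i j : right_distributive (@qscale i j) +%R.
Proof.
move=> a x y; rewrite -(zreprK x) -(zreprK y) -zclassD !qscaleE -zclassD.
exact/zclassP/CscaleDr.
Qed.
Let qscaleDl i j (x : zquot i j) : {morph (@qscale i j)^~ x : a b / a + b}.
Proof.
move=> a b; rewrite -(zreprK x) !qscaleE -zclassD.
exact/zclassP/CscaleDl.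
Qed.

HB.instance Definition _ i j := GRing.Zmodule_isLmodule.Build k (zquot i j)
  (@qscaleA i j) (@qscale1 i j) (@qscaleDr i j) (@qscaleDl i j).

Lemma zclassZ i j c (t : zterm i j) : zclass (Tscale c t) = c *: zclass t.
Proof. exact/esym/qscaleE. Qed.

Definition presented_zalg : zalg k.
Proof.
refine (@ZAlg k (fun i j => zquot i j : lmodType k) qmul
  (fun i => zclass (@Tconst i 1)) _ _ _ _ _ _ _).
- move=> i j l x y z; rewrite -(zreprK x) -(zreprK y) -(zreprK z).
  by rewrite -zclassD !qmulE -zclassD; exact/zclassP/CmulDl.
- move=> i j l x y z; rewrite -(zreprK x) -(zreprK y) -(zreprK z).
  by rewrite -zclassD !qmulE -zclassD; exact/zclassP/CmulDr.
- move=> i j l c x y; rewrite -(zreprK x) -(zreprK y).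
  by rewrite -zclassZ !qmulE -zclassZ; exact/zclassP/CmulZl.
- move=> i j l c x y; rewrite -(zreprK x) -(zreprK y).
  by rewrite -zclassZ !qmulE -zclassZ; exact/zclassP/CmulZr.
- move=> i j l m x y z; rewrite -(zreprK x) -(zreprK y) -(zreprK z).
  by rewrite !qmulE; exact/zclassP/CmulA.
- by move=> i j x; rewrite -(zreprK x) qmulE; exact/zclassP/Cmul1l.
- by move=> i j x; rewrite -(zreprK x) qmulE; exact/zclassP/Cmul1r.
Defined.

End Presented.

Section SncBimod.
Variables (k : fieldType) (K0 K1 : kalg k) (M : bimod K0 K1).

(* Q_i: the elements a . (sum_j m_j (x) m_j^* ), a in K_i, of
   M^{i*} (x) M^{(i+1)*}, for dual bases (m_j), (m_j^* ). *)
Definition unit_rel (i : int) (s : seq (dualz M i * dualz M (succz i))) : Prop :=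
  exists (n : nat) (m : 'I_n -> dualz M i) (m' : 'I_n -> dualz M (succz i))
         (a : Kz K0 K1 i),
    [/\ right_basis m,
        forall j l, dual_pairing (m' j) (m l) = (j == l)%:R
      & s = [seq (lact a (m j), m' j) | j <- enum 'I_n]].

(* Meaningful for M admissible. *)
Definition Snc : zalg k :=
  presented_zalg (@ZPres k (Kz K0 K1) (dualz M) unit_rel).

End SncBimod.

Record lincat (k : fieldType) := LinCat {
  obj :> Type;
  hom : obj -> obj -> lmodType k;
  idm : forall X, hom X X;
  cmp : forall X Y Z, hom Y Z -> hom X Y -> hom X Z;
  cmpA : forall X Y Z T (h : hom Z T) (g : hom Y Z) (f : hom X Y),
    cmp h (cmp g f) = cmp (cmp h g) f;
  cmp1m : forall X Y (f : hom X Y), cmp (idm Y) f = f;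
  cmpm1 : forall X Y (f : hom X Y), cmp f (idm X) = f;
  cmpDl : forall X Y Z (g g' : hom Y Z) (f : hom X Y),
    cmp (g + g') f = cmp g f + cmp g' f;
  cmpDr : forall X Y Z (g : hom Y Z) (f f' : hom X Y),
    cmp g (f + f') = cmp g f + cmp g f';
  cmpZl : forall X Y Z c (g : hom Y Z) (f : hom X Y),
    cmp (c *: g) f = c *: cmp g f;
  cmpZr : forall X Y Z c (g : hom Y Z) (f : hom X Y),
    cmp g (c *: f) = c *: cmp g f;
}.

Notation "g \oc f" := (cmp g f) (at level 40, left associativity).

Section Abelian.
Variables (k : fieldType) (C : lincat k).

Definition monic (X Y : C) (f : hom X Y) : Prop :=
  forall (T : C) (u v : hom T X), f \oc u = f \oc v -> u = v.

Definition epic (X Y : C) (f : hom X Y) : Prop :=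
  forall (T : C) (u v : hom Y T), u \oc f = v \oc f -> u = v.

Definition is_kernel (X Y N : C) (f : hom X Y) (m : hom N X) : Prop :=
  f \oc m = 0 /\
  forall (T : C) (t : hom T X), f \oc t = 0 -> exists! u : hom T N, m \oc u = t.

Definition is_cokernel (X Y Q : C) (f : hom X Y) (q : hom Y Q) : Prop :=
  q \oc f = 0 /\
  forall (T : C) (t : hom Y T), t \oc f = 0 -> exists! u : hom Q T, u \oc q = t.

Definition is_zero_obj (Z : C) : Prop :=
  forall X : C, (forall f : hom X Z, f = 0) /\ (forall f : hom Z X, f = 0).

Definition is_biproduct (X Y B : C) (iX : hom X B) (iY : hom Y B)
    (pX : hom B X) (pY : hom B Y) : Prop :=
  [/\ pX \oc iX = idm X, pY \oc iY = idm Y, pX \oc iY = 0, pY \oc iX = 0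
    & iX \oc pX + iY \oc pY = idm B].

Definition abelian : Prop :=
  [/\ exists Z : C, is_zero_obj Z,
      forall X Y : C, exists (B : C) (iX : hom X B) (iY : hom Y B)
        (pX : hom B X) (pY : hom B Y), is_biproduct iX iY pX pY,
      forall (X Y : C) (f : hom X Y),
        (exists (N : C) (m : hom N X), is_kernel f m) /\
        (exists (Q : C) (q : hom Y Q), is_cokernel f q),
      forall (X Y : C) (f : hom X Y), monic f ->
        exists (Z : C) (g : hom Y Z), is_kernel g f
    & forall (X Y : C) (f : hom X Y), epic f ->
        exists (Z : C) (g : hom Z X), is_cokernel g f].

(* B = X^n, with injections [inj] and projections [prj]. *)
Definition is_power (X : C) (n : nat) (B : C)
    (inj : 'I_n -> hom X B) (prj : 'I_n -> hom B X) : Prop :=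
  (forall j l, prj j \oc inj l = if j == l then idm X else 0) /\
  \sum_j inj j \oc prj j = idm B.

(* 0 -> X -> Y -> Z -> 0; as f is monic, exactness at Y says that f is a
   kernel of g. *)
Definition short_exact (X Y Z : C) (f : hom X Y) (g : hom Y Z) : Prop :=
  [/\ monic f, epic g & is_kernel g f].

End Abelian.

Section EndoAlgebra.
Variables (k : fieldType) (C : lincat k) (X : C).

Definition endo_ring : Type := hom X X.

HB.instance Definition _ := GRing.Lmodule.copy endo_ring (hom X X).

Let endo_mul (f g : endo_ring) : endo_ring := f \oc g.

Let endoA : associative endo_mul.
Proof. by move=> f g h; apply: cmpA. Qed.
Let endo1l : left_id (idm X : endo_ring) endo_mul.
Proof. by move=> f; apply: cmp1m. Qed.
Let endo1r : right_id (idm X : endo_ring) endo_mul.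
Proof. by move=> f; apply: cmpm1. Qed.
Let endoDl : left_distributive endo_mul +%R.
Proof. by move=> f g h; apply: cmpDl. Qed.
Let endoDr : right_distributive endo_mul +%R.
Proof. by move=> f g h; apply: cmpDr. Qed.

HB.instance Definition _ := GRing.Zmodule_isPzRing.Build endo_ring
  endoA endo1l endo1r endoDl endoDr.

Definition endo_kin (c : k) : endo_ring := c *: idm X.

Let endo_kin_additive : additive endo_kin.
Proof. by move=> a b; rewrite /endo_kin scalerBl. Qed.
Let endo_kin_monoid : monoid_morphism endo_kin.
Proof.
split=> [|a b]; first exact: scale1r.
by rewrite /endo_kin [RHS]cmpZl cmp1m scalerA.
Qed.

HB.instance Definition _ := GRing.isAdditive.Build k endo_ring endo_kin
  endo_kin_additive.
HB.instance Definition _ := GRing.isMonoidMorphism.Build k endo_ring endo_kin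
  endo_kin_monoid.

Definition endo : kalg k.
Proof.
exists endo_ring endo_kin => c x.
by rewrite [LHS]cmpZl [RHS]cmpZr cmp1m cmpm1.
Defined.

End EndoAlgebra.

Definition hom_bimod (k : fieldType) (C : lincat k) (X Y : C) :
  bimod (endo Y) (endo X).
Proof.
refine (@Bimod k (endo Y) (endo X) (hom X Y)
  (fun (a : endo Y) f => (a : hom Y Y) \oc f)
  (fun f (b : endo X) => f \oc (b : hom X X)) _ _ _ _ _ _ _ _ _ _).
- by move=> a b f; rewrite [LHS]cmpDl.
- by move=> a f g; rewrite cmpDr.
- by move=> a b f; rewrite cmpA.
- by move=> f; rewrite [LHS]cmp1m.
- by move=> f g b; rewrite cmpDl.
- by move=> f a b; rewrite [LHS]cmpDr.
- by move=> f a b; rewrite -cmpA.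
- by move=> f; rewrite [LHS]cmpm1.
- by move=> a f b; rewrite cmpA.
- by move=> c f; rewrite [LHS]cmpZl [RHS]cmpZr cmp1m cmpm1.
Defined.

Section SncSeq.
Variables (k : fieldType) (C : lincat k) (L : int -> C).

(* The component (i, i+1) is generated by Hom(L_{-(i+1)}, L_{-i}). *)
Definition seqM (i : int) : bimod (endo (L (- i))) (endo (L (- succz i))) :=
  hom_bimod (L (- succz i)) (L (- i)).

Definition comp_rel (i : int) (s : seq (seqM i * seqM (succz i))) : Prop :=
  \sum_(p <- s) (p.1 : hom (L (- succz i)) (L (- i))) \oc p.2 = 0.

Definition SncSeq : zalg k :=
  presented_zalg (@ZPres k (fun i => endo (L (- i))) seqM comp_rel).

End SncSeq.

Section Euler.
Variables (k : fieldType) (C : lincat k).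

(* A short exact sequence 0 -> X -> *Hom(X, Y) (x) Y -> Z -> 0 whose first map
   is the canonical one; the middle term is Y^n, formed with respect to a left
   basis [eul_b] of Hom(X, Y). *)
Definition eta (X Y : C) (n : nat) (b : 'I_n -> hom X Y) (B : C)
    (inj : 'I_n -> hom Y B) : hom X B :=
  \sum_j inj j \oc b j.

Record euler (X Y Z : C) := Euler {
  eul_n : nat;
  eul_b : 'I_eul_n -> hom X Y;
  eul_basis : @left_basis k _ _ (hom_bimod X Y) eul_n eul_b;
  eul_mid : C;
  eul_inj : 'I_eul_n -> hom Y eul_mid;
  eul_prj : 'I_eul_n -> hom eul_mid Y;
  eul_power : is_power eul_inj eul_prj;
  eul_quo : hom eul_mid Z;
  eul_exact : short_exact (eta eul_b eul_inj) eul_quo;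
}.
Arguments eul_b {X Y Z} E _ : rename.
Arguments eul_inj {X Y Z} E _ : rename.
Arguments eul_prj {X Y Z} E _ : rename.

Variables (X Y Z : C) (E : euler X Y Z).

(* With b_j d = sum_l a_{jl} b_l, the endomorphism of *Hom(X, Y) (x) Y induced
   by d is (y_l)_l |-> (sum_l a_{jl} y_l)_j, because d . b_l^* = sum_j b_j^* a_{jl}. *)
Definition eul_act (a : 'M[endo Y]_(eul_n E)) : hom (eul_mid E) (eul_mid E) :=
  \sum_j \sum_l eul_inj E j \oc (a j l : hom Y Y) \oc eul_prj E l.

Definition is_eul_phi (Phi : endo X -> endo Z) : Prop :=
  forall (d : endo X) (a : 'M[endo Y]_(eul_n E)),
    (forall j, eul_b E j \oc d = \sum_l (a j l : hom Y Y) \oc eul_b E l) ->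
    (Phi d : hom Z Z) \oc eul_quo E = eul_quo E \oc eul_act a.

(* Hom(Y, -) of the quotient map, after *H = Hom(Y, *H (x) Y), which sends phi
   to sum_j b_j^* (x) phi(b_j). *)
Definition eul_can (phi : ldual (hom_bimod X Y)) : hom Y Z :=
  eul_quo E \oc \sum_j eul_inj E j \oc (phi (eul_b E j) : hom Y Y).

End Euler.

(* The map Phi_i is determined by [is_eul_phi], the quotient map being epic. *)
Definition helix (k : fieldType) (C : lincat k) (L : int -> C) : Prop :=
  forall i : int,
    let X := L i in let Y := L (succz i) in let Z := L (succz (succz i)) in
    [/\ division_ring (endo X),
        left_findim (hom_bimod X Y) /\ right_findim (hom_bimod X Y)
      & exists (E : euler X Y Z) (Phi : {rmorphism endo X -> endo Z})
               (Phik : forall c : k, Phi (kin (endo X) c) = kin (endo Z) c),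
          [/\ is_eul_phi E Phi, bijective Phi
            & @bimod_iso k _ _ (ldual (hom_bimod X Y))
                (lrestrict Phik (hom_bimod Y Z)) (@eul_can _ _ _ _ _ E)]].

(* Main.v *)
From HB Require Import structures.
From mathcomp Require Import all_boot all_algebra.
From mathcomp Require Import boolp.
Require Import Defs.

Set Implicit Arguments.
Unset Strict Implicit.
Unset Printing Implicit Defensive.

Import GRing.Theory.
Local Open Scope ring_scope.

(* The Euler sequence gives a perfect pairing between H_i = Hom(L_i, L_{i+1})
   and H_{i+1}, which identifies H_{i+1} with *H_i, and hence H_i with
   H_{i+1}^*. Starting from M = H_{-1} and iterating in both directions, this
   identifies M^{i*} with H_{-i-1}, semilinearly along isomorphisms K_i -> D_{-i}
   obtained by composing the maps Phi, and compatibly with the evaluation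
   pairings. Applying Hom(L_i, -) to the Euler sequence shows that the kernel of
   H_{i+1} (x) H_i -> Hom(L_i, L_{i+2}) is spanned over D_i by the canonical
   element of *H_i (x) H_i, so that the quadratic relations correspond too. *)

(** * Isomorphisms of k-algebras *)

Record kalg_iso (k : fieldType) (R S : kalg k) := KalgIso {
  kfun :> R -> S;
  kinv : S -> R;
  kfunK : cancel kfun kinv;
  kinvK : cancel kinv kfun;
  kfunD : forall a b, kfun (a + b) = kfun a + kfun b;
  kfunM : forall a b, kfun (a * b) = kfun a * kfun b;
  kfun1 : kfun 1 = 1;
  kfunk : forall c : k, kfun (kin R c) = kin S c;
}.

Section KalgIso.
Variables (k : fieldType).
Implicit Types R S T : kalg k.

Definition kalg_iso_id R : kalg_iso R R.
Proof. by exists id id. Defined.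

Definition kalg_iso_sym R S (s : kalg_iso R S) : kalg_iso S R.
Proof.
exists (kinv s) s; first exact: kinvK; first exact: kfunK.
- by move=> a b; apply: (can_inj (kfunK s)); rewrite kfunD !kinvK.
- by move=> a b; apply: (can_inj (kfunK s)); rewrite kfunM !kinvK.
- by rewrite -(kfun1 s) kfunK.
- by move=> c; rewrite -(kfunk s) kfunK.
Defined.

Definition kalg_iso_comp R S T (s : kalg_iso R S) (t : kalg_iso S T) :
  kalg_iso R T.
Proof.
exists (t \o s) (kinv s \o kinv t).
- exact: can_comp (kfunK t) (kfunK s).
- exact: can_comp (kinvK s) (kinvK t).
- by move=> a b /=; rewrite !kfunD.
- by move=> a b /=; rewrite !kfunM.
- by rewrite /= !kfun1.
- by move=> c; rewrite /= !kfunk.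
Defined.

Lemma kfun0 R S (s : kalg_iso R S) : s 0 = 0.
Proof. by apply: (addrI (s 0)); rewrite -kfunD !addr0. Qed.

Lemma kinvD R S (s : kalg_iso R S) a b : kinv s (a + b) = kinv s a + kinv s b.
Proof. exact: (kfunD (kalg_iso_sym s)). Qed.

Lemma kinvM R S (s : kalg_iso R S) a b : kinv s (a * b) = kinv s a * kinv s b.
Proof. exact: (kfunM (kalg_iso_sym s)). Qed.

Lemma kfun_nat R S (s : kalg_iso R S) (b : bool) : s b%:R = b%:R.
Proof. by case: b; rewrite ?kfun1 ?kfun0. Qed.

End KalgIso.

(** * Semilinear isomorphisms of bimodules *)

Section Bimodules.
Variables (k : fieldType) (R S : kalg k) (N : bimod R S).

Lemma lact0l (x : N) : lact 0 x = 0.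
Proof. by apply: (addrI (lact 0 x)); rewrite -lactDl !addr0. Qed.

Lemma lact0r (a : R) : lact a (0 : N) = 0.
Proof. by apply: (addrI (lact a 0)); rewrite -lactDr !addr0. Qed.

Lemma lactNl a (x : N) : lact (- a) x = - lact a x.
Proof. by apply: (addrI (lact a x)); rewrite -lactDl !subrr lact0l. Qed.

Lemma lact_sumr (I : Type) (r : seq I) (F : I -> N) (a : R) :
  lact a (\sum_(i <- r) F i) = \sum_(i <- r) lact a (F i).
Proof. exact: (big_morph (lact a) (lactDr a) (lact0r a)). Qed.

End Bimodules.

(** The scalars may change on both sides, because the iterated duals of a bimodule live over only
    two algebras, whereas each object of a helix has its own endomorphism algebra. *)
Record bimod_siso (k : fieldType) (R S R' S' : kalg k) (s : kalg_iso R R')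
    (t : kalg_iso S S') (M : bimod R S) (N : bimod R' S') := BimodSiso {
  sfun :> M -> N;
  sinv : N -> M;
  sfunK : cancel sfun sinv;
  sinvK : cancel sinv sfun;
  sfunD : forall x y, sfun (x + y) = sfun x + sfun y;
  sfunl : forall a x, sfun (lact a x) = lact (s a) (sfun x);
  sfunr : forall x b, sfun (ract x b) = ract (sfun x) (t b);
}.

Section BimodSiso.
Variables (k : fieldType) (R S R' S' : kalg k) (s : kalg_iso R R').
Variables (t : kalg_iso S S') (M : bimod R S) (N : bimod R' S').

Definition bimod_siso_sym (f : bimod_siso s t M N) :
  bimod_siso (kalg_iso_sym s) (kalg_iso_sym t) N M.
Proof.
exists (sinv f) f; first exact: sinvK; first exact: sfunK.
- by move=> x y; apply: (can_inj (sfunK f)); rewrite sfunD !sinvK.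
- by move=> a x; apply: (can_inj (sfunK f)); rewrite sfunl !sinvK kinvK.
- by move=> x b; apply: (can_inj (sfunK f)); rewrite sfunr !sinvK kinvK.
Defined.

Variable f : bimod_siso s t M N.

Lemma sinvl a x : sinv f (lact a x) = lact (kinv s a) (sinv f x).
Proof. exact: (sfunl (bimod_siso_sym f)). Qed.

Lemma sinvr x b : sinv f (ract x b) = ract (sinv f x) (kinv t b).
Proof. exact: (sfunr (bimod_siso_sym f)). Qed.

Lemma sfun0 : f 0 = 0.
Proof. by apply: (addrI (f 0)); rewrite -sfunD !addr0. Qed.

Lemma sfun_sum (I : Type) (r : seq I) (F : I -> M) :
  f (\sum_(i <- r) F i) = \sum_(i <- r) f (F i).
Proof. exact: (big_morph f (sfunD f) sfun0). Qed.

End BimodSiso.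

Lemma sinv_sum (k : fieldType) (R S R' S' : kalg k) (s : kalg_iso R R')
    (t : kalg_iso S S') (M : bimod R S) (N : bimod R' S') (f : bimod_siso s t M N)
    (I : Type) (r : seq I) (F : I -> N) :
  sinv f (\sum_(i <- r) F i) = \sum_(i <- r) sinv f (F i).
Proof. exact: (sfun_sum (bimod_siso_sym f)). Qed.

Section TransportBases.
Variables (k : fieldType) (R S R' S' : kalg k) (s : kalg_iso R R').
Variables (t : kalg_iso S S') (M : bimod R S) (N : bimod R' S').
Variable f : bimod_siso s t M N.

Lemma siso_right_basis n (b : 'I_n -> M) :
  right_basis b -> right_basis (f \o b).
Proof.
move=> [b_free b_span]; split=> [c cb0 j|x].
  have /(_ j) /= cj0 : forall j, (kinv t \o c) j = 0.
    apply: b_free; apply: (can_inj (sfunK f)); rewrite sfun_sum sfun0 -[RHS]cb0.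
    by apply: eq_bigr => i _ /=; rewrite sfunr kinvK.
  by rewrite -(kinvK t (c j)) cj0 kfun0.
have [c xE] := b_span (sinv f x); exists (t \o c).
rewrite -[LHS](sinvK f) xE sfun_sum.
by apply: eq_bigr => i _; rewrite sfunr.
Qed.

Lemma siso_left_basis n (b : 'I_n -> M) :
  left_basis b -> left_basis (f \o b).
Proof.
move=> [b_free b_span]; split=> [c cb0 j|x].
  have /(_ j) /= cj0 : forall j, (kinv s \o c) j = 0.
    apply: b_free; apply: (can_inj (sfunK f)); rewrite sfun_sum sfun0 -[RHS]cb0.
    by apply: eq_bigr => i _ /=; rewrite sfunl kinvK.
  by rewrite -(kinvK s (c j)) cj0 kfun0.
have [c xE] := b_span (sinv f x); exists (s \o c).
rewrite -[LHS](sinvK f) xE sfun_sum.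
by apply: eq_bigr => i _; rewrite sfunl.
Qed.

Lemma siso_left_findim : left_findim M -> left_findim N.
Proof. by move=> [n [b /siso_left_basis fb]]; exists n, (f \o b). Qed.

Lemma siso_right_findim : right_findim M -> right_findim N.
Proof. by move=> [n [b /siso_right_basis fb]]; exists n, (f \o b). Qed.

End TransportBases.

(** * Dual bases and dualities *)

Section LeftDualBasis.
Variables (k : fieldType) (R S : kalg k) (N : bimod R S).

Lemma ldual0 (phi : ldual N) : ldual_fun phi 0 = 0.
Proof. by apply: (addrI (ldual_fun phi 0)); rewrite -ldualD !addr0. Qed.

Lemma ldual_sum (phi : ldual N) (I : Type) (r : seq I) (F : I -> N) :
  ldual_fun phi (\sum_(i <- r) F i) = \sum_(i <- r) ldual_fun phi (F i).
Proof. exact: (big_morph _ (ldualD phi) (ldual0 phi)). Qed.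

Lemma ldual_sumE (I : Type) (r : seq I) (F : I -> ldual N) x :
  ldual_fun (\sum_(i <- r) F i : ldual N) x = \sum_(i <- r) ldual_fun (F i) x.
Proof.
exact: (big_morph (fun phi : ldual N => ldual_fun phi x)
  (fun _ _ => erefl) erefl).
Qed.

(** The dual basis consists of the coordinate functions. They are obtained by choice, and uniqueness
    of coordinates makes them additive and linear. *)
Lemma left_dual_basis n (b : 'I_n -> N) : left_basis b ->
  exists bs : 'I_n -> ldual N,
    (forall j l, ldual_fun (bs l) (b j) = (j == l)%:R) /\
    forall x, x = \sum_l lact (ldual_fun (bs l) x) (b l).
Proof.
move=> [b_free b_span]; pose c x := projT1 (cid (b_span x)).
have cE x : x = \sum_l lact (c x l) (b l) := projT2 (cid (b_span x)).
have c_unique x u : x = \sum_l lact (u l) (b l) -> u =1 c x.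
  move=> xE j; apply/eqP; rewrite -subr_eq0; apply/eqP.
  apply: (b_free (fun l => u l - c x l)).
  under eq_bigr do rewrite lactDl lactNl.
  by rewrite sumrB -xE -cE subrr.
have cD l x y : c (x + y) l = c x l + c y l.
  apply/esym/(c_unique _ (fun l => c x l + c y l)).
  by under eq_bigr do rewrite lactDl; rewrite big_split -!cE.
have cZ l a x : c (lact a x) l = a * c x l.
  apply/esym/(c_unique _ (fun l => a * c x l)).
  by under eq_bigr do rewrite -lactA; rewrite -lact_sumr -cE.
exists (fun l => LDual (cD l) (cZ l)); split=> [j l|x] /=; last exact: cE.
apply/esym/(c_unique _ (fun l => (j == l)%:R)).
rewrite (bigD1 j) //= eqxx lact1 big1 ?addr0 // => i ij.
by rewrite eq_sym (negPf ij) lact0l.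
Qed.

End LeftDualBasis.

(* [N] is the left dual of [P], and [P] the right dual of [N], the scalars on
   the outer sides being identified by [Phi]; [dleft] and [dright] are dual
   bases. *)
Record duality (k : fieldType) (R S T : kalg k) (Phi : kalg_iso S T)
    (P : bimod R S) (N : bimod T R) := Duality {
  pairing : P -> N -> R;
  pairDl : forall x y z, pairing (x + y) z = pairing x z + pairing y z;
  pairDr : forall x y z, pairing x (y + z) = pairing x y + pairing x z;
  pairZl : forall a x y, pairing (lact a x) y = a * pairing x y;
  pairZr : forall x y b, pairing x (ract y b) = pairing x y * b;
  pairA : forall x d y, pairing (ract x d) y = pairing x (lact (Phi d) y);
  ddim : nat;
  dleft : 'I_ddim -> P;
  dright : 'I_ddim -> N;
  pair_dual : forall j l, pairing (dleft j) (dright l) = (j == l)%:R;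
  dleft_expand : forall x, x = \sum_l lact (pairing x (dright l)) (dleft l);
  dright_expand : forall y, y = \sum_l ract (dright l) (pairing (dleft l) y);
}.
Arguments dleft {k R S T Phi P N} d _ : rename.
Arguments dright {k R S T Phi P N} d _ : rename.

Section Duality.
Variables (k : fieldType) (R S T : kalg k) (Phi : kalg_iso S T).
Variables (P : bimod R S) (N : bimod T R) (d : duality Phi P N).

Lemma pair0l y : pairing d 0 y = 0.
Proof. by apply: (addrI (pairing d 0 y)); rewrite -pairDl !addr0. Qed.

Lemma pair0r x : pairing d x 0 = 0.
Proof. by apply: (addrI (pairing d x 0)); rewrite -pairDr !addr0. Qed.

Lemma pair_suml (I : Type) (r : seq I) (F : I -> P) y :
  pairing d (\sum_(i <- r) F i) y = \sum_(i <- r) pairing d (F i) y.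
Proof.
exact: (big_morph (pairing d ^~ y) (fun x z => pairDl d x z y) (pair0l y)).
Qed.

Lemma pair_sumr (I : Type) (r : seq I) (F : I -> N) x :
  pairing d x (\sum_(i <- r) F i) = \sum_(i <- r) pairing d x (F i).
Proof. exact: (big_morph (pairing d x) (pairDr d x) (pair0r x)). Qed.

Lemma pair_injl x y : (forall z, pairing d x z = pairing d y z) -> x = y.
Proof.
move=> xy; rewrite (dleft_expand d x) (dleft_expand d y).
by apply: eq_bigr => l _; rewrite xy.
Qed.

Lemma pair_injr x y : (forall z, pairing d z x = pairing d z y) -> x = y.
Proof.
move=> xy; rewrite (dright_expand d x) (dright_expand d y).
by apply: eq_bigr => l _; rewrite xy.
Qed.

Lemma dright_basis : right_basis (dright d).
Proof.
split=> [c c0 j|y]; last first.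
  by exists (fun l => pairing d (dleft d l) y); exact: dright_expand.
have := pair0r (dleft d j); rewrite -c0 pair_sumr (bigD1 j) //= big1 => [|l lj].
  by rewrite pairZr pair_dual eqxx mul1r addr0.
by rewrite pairZr pair_dual eq_sym (negPf lj) mul0r.
Qed.

(** Pairing an expansion of [y] with [m' j] isolates its j-th coefficient. The bases are arbitrary,
    as they are in [unit_rel]. *)
Lemma right_basis_expand n (m : 'I_n -> N) (m' : 'I_n -> P) :
    right_basis m -> (forall j l, pairing d (m' j) (m l) = (j == l)%:R) ->
  forall y, y = \sum_j ract (m j) (pairing d (m' j) y).
Proof.
move=> [_ m_span] mm' y; have [c yE] := m_span y.
rewrite {1}yE; apply: eq_bigr => j _; congr ract.
rewrite yE pair_sumr (bigD1 j) //= big1 => [|l lj].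
  by rewrite pairZr mm' eqxx mul1r addr0.
by rewrite pairZr mm' eq_sym (negPf lj) mul0r.
Qed.

End Duality.

(* An identification [f] of [M] with one side of a duality turns the pairing
   into the evaluation pairing of [M] with its dual, which identifies that dual
   with the other side. *)

Section RightDualOfDuality.
Variables (k : fieldType) (R S T : kalg k) (Phi : kalg_iso S T).
Variables (P : bimod R S) (N : bimod T R) (d : duality Phi P N).
Variables (R0 S0 : kalg k) (s : kalg_iso R0 T) (t : kalg_iso S0 R).
Variables (M : bimod R0 S0) (f : bimod_siso s t M N).

Let g (phi : rdual M) : P :=
  \sum_l lact (t (rdual_fun phi (sinv f (dright d l)))) (dleft d l).

(** This identity determines [g phi], the pairing being nondegenerate; every property of the
    isomorphism is read off from it. *)
Let pair_g phi y : pairing d (g phi) (f y) = t (rdual_fun phi y).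
Proof.
have yE : y = \sum_l ract (sinv f (dright d l))
                          (kinv t (pairing d (dleft d l) (f y))).
  apply: (can_inj (sfunK f)); rewrite sfun_sum {1}(dright_expand d (f y)).
  by apply: eq_bigr => l _; rewrite sfunr sinvK kinvK.
have phi0 : rdual_fun phi 0 = 0.
  by apply: (addrI (rdual_fun phi 0)); rewrite -rdualD !addr0.
rewrite pair_suml {2}yE (big_morph _ (rdualD phi) phi0).
rewrite (big_morph _ (kfunD t) (kfun0 t)); apply: eq_bigr => l _.
by rewrite pairZl rdualZ kfunM kinvK.
Qed.

Let ginv (x : P) : rdual M.
Proof.
apply: (@RDual _ _ _ M (fun y => kinv t (pairing d x (f y)))) => [y z|y b].
  by rewrite sfunD pairDr kinvD.
by rewrite sfunr pairZr kinvM kfunK.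
Defined.

Definition rdual_siso :
  bimod_siso t (kalg_iso_comp s (kalg_iso_sym Phi)) (rdual M) P.
Proof.
exists g ginv.
- by move=> phi; apply: rdualP => y; rewrite /= pair_g kfunK.
- move=> x; apply: (pair_injl (d := d)) => z.
  by rewrite -[z](sinvK f) pair_g /= kinvK.
- move=> phi psi; apply: (pair_injl (d := d)) => z.
  by rewrite -[z](sinvK f) pairDl !pair_g /= kfunD.
- move=> a phi; apply: (pair_injl (d := d)) => z.
  by rewrite -[z](sinvK f) pairZl !pair_g /= kfunM.
- move=> phi b; apply: (pair_injl (d := d)) => z.
  by rewrite -[z](sinvK f) pairA /= kinvK -sfunl !pair_g.
Defined.

Lemma rdual_siso_pair (phi : rdual M) y :
  pairing d (rdual_siso phi) (f y) = t (rdual_fun phi y).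
Proof. exact: pair_g. Qed.

End RightDualOfDuality.

Section LeftDualOfDuality.
Variables (k : fieldType) (R S T : kalg k) (Phi : kalg_iso S T).
Variables (P : bimod R S) (N : bimod T R) (d : duality Phi P N).
Variables (R0 S0 : kalg k) (t : kalg_iso R0 R) (s : kalg_iso S0 S).
Variables (M : bimod R0 S0) (f : bimod_siso t s M P).

Let g (phi : ldual M) : N :=
  \sum_l ract (dright d l) (t (ldual_fun phi (sinv f (dleft d l)))).

Let pair_g phi x : pairing d (f x) (g phi) = t (ldual_fun phi x).
Proof.
have xE : x = \sum_l lact (kinv t (pairing d (f x) (dright d l)))
                          (sinv f (dleft d l)).
  apply: (can_inj (sfunK f)); rewrite sfun_sum {1}(dleft_expand d (f x)).
  by apply: eq_bigr => l _; rewrite sfunl sinvK kinvK.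
rewrite pair_sumr {2}xE ldual_sum.
rewrite (big_morph _ (kfunD t) (kfun0 t)); apply: eq_bigr => l _.
by rewrite pairZr ldualZ kfunM kinvK.
Qed.

Let ginv (y : N) : ldual M.
Proof.
apply: (@LDual _ _ _ M (fun x => kinv t (pairing d (f x) y))) => [x z|a x].
  by rewrite sfunD pairDl kinvD.
by rewrite sfunl pairZl kinvM kfunK.
Defined.

Definition ldual_siso : bimod_siso (kalg_iso_comp s Phi) t (ldual M) N.
Proof.
exists g ginv.
- by move=> phi; apply: ldualP => y; rewrite /= pair_g kfunK.
- move=> y; apply: (pair_injr (d := d)) => z.
  by rewrite -[z](sinvK f) pair_g /= kinvK.
- move=> phi psi; apply: (pair_injr (d := d)) => z.
  by rewrite -[z](sinvK f) pairDr !pair_g /= kfunD.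
- move=> a phi; apply: (pair_injr (d := d)) => z.
  by rewrite -[z](sinvK f) -pairA -sfunr !pair_g.
- move=> phi b; apply: (pair_injr (d := d)) => z.
  by rewrite -[z](sinvK f) pairZr !pair_g /= kfunM.
Defined.

Lemma ldual_siso_pair (phi : ldual M) x :
  pairing d (f x) (ldual_siso phi) = t (ldual_fun phi x).
Proof. exact: pair_g. Qed.

End LeftDualOfDuality.

(** * Iterated duals along a chain of dualities *)

Section DualChain.
Variables (k : fieldType) (D : int -> kalg k).
Variable N : forall i, bimod (D i) (D (succz i)).
Variable Phi : forall i, kalg_iso (D (succz (succz i))) (D i).
Variable d : forall i, duality (Phi i) (N (succz i)) (N i).

Let K := Kz (D 0) (D 1).
Let M : bimod (D 0) (D 1) := N 0.

(** The algebras [Kseq] repeat with period 2, so the recursion goes by two steps. [Phi] lowers the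
    index by 2, hence its inverse serves here and [Phi] itself on the negative side, which starts
    from [D 1] and [D 0]. *)
Fixpoint chain_scalarP (n : nat) :
    kalg_iso (Kseq (D 0) (D 1) n) (D (Posz n)) :=
  match n with
  | 0 => kalg_iso_id (D 0)
  | 1 => kalg_iso_id (D 1)
  | n'.+2 => kalg_iso_comp (chain_scalarP n') (kalg_iso_sym (Phi (Posz n')))
  end.

Fixpoint chain_scalarN (n : nat) :
    kalg_iso (Kseq (D 0) (D 1) n.+1) (D (Negz n)) :=
  match n with
  | 0 => kalg_iso_comp (chain_scalarP 1) (Phi (Negz 0))
  | 1 => kalg_iso_comp (chain_scalarP 0) (Phi (Negz 1))
  | n'.+2 => kalg_iso_comp (chain_scalarN n') (Phi (Negz n'.+2))
  end.

Definition chain_scalar (i : int) : kalg_iso (K i) (D i) :=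
  match i with
  | Posz n => chain_scalarP n
  | Negz n => chain_scalarN n
  end.

Let chain_siso (i : int) :=
  bimod_siso (chain_scalar i) (chain_scalar (succz i)) (dualz M i) (N i).

Fixpoint chain_isoP (n : nat) : chain_siso (Posz n) :=
  match n with
  | 0 => @BimodSiso k _ _ _ _ (kalg_iso_id (D 0)) (kalg_iso_id (D 1)) M M
           id id (frefl _) (frefl _) (fun _ _ => erefl) (fun _ _ => erefl)
           (fun _ _ => erefl)
  | n'.+1 => rdual_siso (d (Posz n')) (chain_isoP n')
  end.

(** The inner case distinction lets [succz] and [chain_scalarN] reduce, so that the scalars on both
    sides agree by conversion. *)
Fixpoint chain_isoN (n : nat) : chain_siso (Negz n) :=
  match n with
  | 0 => ldual_siso (d (Negz 0)) (chain_isoP 0)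
  | n'.+1 =>
    match n' return chain_siso (Negz n') -> chain_siso (Negz n'.+1) with
    | 0 => fun f => ldual_siso (d (Negz 1)) f
    | n''.+1 => fun f => ldual_siso (d (Negz n''.+2)) f
    end (chain_isoN n')
  end.

Definition chain_iso (i : int) : chain_siso i :=
  match i with
  | Posz n => chain_isoP n
  | Negz n => chain_isoN n
  end.

(** Serves to carry dual bases for the evaluation pairing to dual bases for [d i] and back. Each
    case is the identity characterizing the dual isomorphism that was used at that index. *)
Lemma chain_iso_pair i (x : dualz M (succz i)) (y : dualz M i) :
  pairing (d i) (chain_iso (succz i) x) (chain_iso i y) =
  chain_scalar (succz i) (dual_pairing x y).
Proof.
case: i x y => [n|[|[|n]]] x y.
- exact: (rdual_siso_pair (d (Posz n)) (chain_isoP n)).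
- exact: (ldual_siso_pair (d (Negz 0)) (chain_isoP 0)).
- exact: (ldual_siso_pair (d (Negz 1)) (chain_isoN 0)).
- exact: (ldual_siso_pair (d (Negz n.+2)) (chain_isoN n.+1)).
Qed.

End DualChain.

(** * From Euler sequences to dualities *)

Section Composition.
Variables (k : fieldType) (C : lincat k).

Lemma cmp0m (X Y Z : C) (f : hom X Y) : (0 : hom Y Z) \oc f = 0.
Proof. by apply: (addrI (0 \oc f)); rewrite -cmpDl !addr0. Qed.

Lemma cmpm0 (X Y Z : C) (g : hom Y Z) : g \oc (0 : hom X Y) = 0.
Proof. by apply: (addrI (g \oc 0)); rewrite -cmpDr !addr0. Qed.

Lemma cmp_suml (X Y Z : C) (I : Type) (r : seq I) (G : I -> hom Y Z)
    (f : hom X Y) :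
  (\sum_(i <- r) G i) \oc f = \sum_(i <- r) G i \oc f.
Proof.
exact: (big_morph (fun g => g \oc f) (fun g h => cmpDl g h f) (cmp0m _ f)).
Qed.

Lemma cmp_sumr (X Y Z : C) (I : Type) (r : seq I) (F : I -> hom X Y)
    (g : hom Y Z) :
  g \oc (\sum_(i <- r) F i) = \sum_(i <- r) g \oc F i.
Proof. exact: (big_morph (cmp g) (cmpDr g) (cmpm0 _ g)). Qed.

End Composition.

(** Stated for three separate objects, so that it can be transported along equalities of indices. *)
Definition helix_step (k : fieldType) (C : lincat k) (X Y Z : C) : Prop :=
  exists (E : euler X Y Z) (Phi : {rmorphism endo X -> endo Z})
         (Phik : forall c : k, Phi (kin (endo X) c) = kin (endo Z) c),
    bijective Phi /\
    @bimod_iso k _ _ (ldual (hom_bimod X Y))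
      (lrestrict Phik (hom_bimod Y Z)) (@eul_can _ _ _ _ _ E).

(* In terms of the dual bases, the kernel of the composition
   Hom(Y, Z) (x) Hom(X, Y) -> Hom(X, Z) is spanned by sum_l b_l^* (x) b_l. *)
Record euler_duality (k : fieldType) (C : lincat k) (X Y Z : C) := EulerDuality {
  eul_Phi : kalg_iso (endo X) (endo Z);
  eul_dual :> duality eul_Phi (hom_bimod X Y) (hom_bimod Y Z);
  eul_dual0 :
    \sum_l (dright eul_dual l : hom Y Z) \oc (dleft eul_dual l : hom X Y) = 0;
  eul_dual_ker : forall y : 'I_(ddim eul_dual) -> hom Y Z,
    \sum_l y l \oc (dleft eul_dual l : hom X Y) = 0 ->
    exists a : endo X,
      forall l, (y l : hom_bimod Y Z) = lact (eul_Phi a) (dright eul_dual l);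
}.

(** Since [eul_can] is bijective, [y] in Hom(Y, Z) corresponds to a functional on Hom(X, Y), and the
    pairing is its evaluation. The two statements on compositions are left exactness of Hom(X, -) on
    the Euler sequence, read in coordinates. *)
Lemma helix_step_duality (k : fieldType) (C : lincat k) (X Y Z : C) :
  helix_step X Y Z -> inhabited (euler_duality X Y Z).
Proof.
move=> [E [Phi [Phik [[Psi PhiK PsiK] [canD canl canr [can' canK can'K]]]]]].
pose H := hom_bimod X Y; pose b : 'I_(eul_n E) -> H := @eul_b _ _ _ _ _ E.
have [bs [bsb bs_expand]] := left_dual_basis (eul_basis E).
pose s : kalg_iso (endo X) (endo Z) :=
  KalgIso PhiK PsiK (rmorphD Phi) (rmorphM Phi) (rmorph1 Phi) Phik.
pose p (f : H) (y : hom_bimod Y Z) : endo Y := ldual_fun (can' y) f.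
have canI := can_inj canK.
have ldual_ext (phi psi : ldual H) :
    (forall j, ldual_fun phi (b j) = ldual_fun psi (b j)) -> phi = psi.
  move=> eqb; apply: ldualP => x; rewrite (bs_expand x) !ldual_sum.
  by apply: eq_bigr => l _; rewrite !ldualZ eqb.
have can'D x y : can' (x + y) = can' x + can' y.
  by apply: canI; rewrite canD !can'K.
have can'r x a : can' (ract (x : hom_bimod Y Z) a) = ract (can' x) a.
  by apply: canI; rewrite canr !can'K.
have can'l x a : can' (lact (s a) (x : hom_bimod Y Z)) = lact a (can' x).
  by apply: canI; rewrite canl !can'K.
have can0 : eul_can E 0 = 0.
  by apply: (addrI (eul_can E 0)); rewrite -canD !addr0.
(* A sum of compositions X -> Y -> Z is lifted to one morphism from X to the middle term, given by
   its components. *)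
have can_cmp (phi : 'I_(eul_n E) -> ldual H) :
    \sum_l eul_can E (phi l) \oc eul_b l =
    eul_quo E \oc \sum_m eul_inj m \oc
      \sum_l (ldual_fun (phi l) (b m) : hom Y Y) \oc eul_b l.
  under eq_bigr do rewrite -cmpA cmp_suml.
  rewrite -cmp_sumr exchange_big; congr (_ \oc _); apply: eq_bigr => m _.
  by rewrite cmp_sumr; apply: eq_bigr => l _; rewrite cmpA.
(* The body of [dual] is kept, since its bases must reduce to [b] and the images of [bs] below. *)
have @dual : duality s H (hom_bimod Y Z).
  apply: (@Duality _ _ _ _ s H (hom_bimod Y Z) p _ _ _ _ _ (eul_n E) b
            (fun l => eul_can E (bs l))); rewrite /p.
  - by move=> x y z; rewrite ldualD.
  - by move=> x y z; rewrite can'D.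
  - by move=> a x y; rewrite ldualZ.
  - by move=> x y a; rewrite can'r.
  - by move=> x a y; rewrite can'l.
  - by move=> j l; rewrite canK bsb.
  - by move=> x; rewrite {1}(bs_expand x); apply: eq_bigr => l _; rewrite canK.
  - move=> y.
    have yE : can' y = \sum_l ract (bs l) (ldual_fun (can' y) (b l)).
      apply: ldualP => x; rewrite ldual_sumE {1}(bs_expand x) ldual_sum.
      by apply: eq_bigr => l _; rewrite ldualZ.
    rewrite -[LHS]can'K {1}yE (big_morph _ canD can0); apply: eq_bigr => l _.
    exact: canr.
have [[prj_inj _] [eta_mono _ [quo_eta eta_ker]]] := (eul_power E, eul_exact E).
constructor; apply: (@EulerDuality _ _ _ _ _ s dual) => [|y y0] /=.
  (* For the dual basis the m-th component is the expansion of [b m], so the lift is the canonical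
     map [eta]. *)
  rewrite can_cmp -[RHS]quo_eta; congr (_ \oc _); apply: eq_bigr => m _.
  by congr (_ \oc _); rewrite [RHS](bs_expand (b m)).
pose phi l := can' (y l).
have yE l : y l = eul_can E (phi l) by rewrite can'K.
pose g m : hom X Y := \sum_l (ldual_fun (phi l) (b m) : hom Y Y) \oc eul_b l.
(* The lift is killed by the quotient map, hence factors through [eta] by an endomorphism [a] of X,
   which is the required scalar. *)
have {y0} /eta_ker [a [aE _]] : eul_quo E \oc \sum_m eul_inj m \oc g m = 0.
  by rewrite -can_cmp -[RHS]y0; apply: eq_bigr => l _; rewrite yE.
have prj_sum m (F : _ -> hom X Y) :
    eul_prj (e := E) m \oc (\sum_j eul_inj j \oc F j) = F m.
  rewrite cmp_sumr (bigD1 m) //= big1 => [|j jm].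
    by rewrite addr0 cmpA prj_inj eqxx cmp1m.
  by rewrite cmpA prj_inj eq_sym (negPf jm) cmp0m.
have gE m : g m = eul_b m \oc a.
  rewrite -(prj_sum m g) -aE /eta cmp_suml.
  by under eq_bigr do rewrite -cmpA; rewrite prj_sum.
exists a => l; rewrite yE; apply: etrans (canl _ _).
(* At [b j] the right side is the l-th coordinate of [b j] composed with [a], that is of [g j], and
   this is the value of [phi l] at [b j]. *)
congr eul_can; apply: ldual_ext => j; rewrite /= -gE ldual_sum (bigD1 l) //=.
rewrite big1 => [|i il]; rewrite ldualZ bsb.
  by rewrite eqxx mulr1 addr0.
by rewrite (negPf il) mulr0.
Qed.

(** * Isomorphisms of presented Z-algebras *)

Section PresentationMap.
Variables (k : fieldType) (P P' : zpres k).
Variable s : forall i, kalg_iso (presK P i) (presK P' i).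
Variable f : forall i, bimod_siso (s i) (s (succz i)) (presM P i) (presM P' i).

Fixpoint zterm_map i j (t : zterm P i j) : zterm P' i j :=
  match t with
  | Tconst i a => Tconst (s i a)
  | Tgen i m => Tgen (f i m)
  | Tzero i j => Tzero P' i j
  | Topp _ _ t => Topp (zterm_map t)
  | Tadd _ _ t u => Tadd (zterm_map t) (zterm_map u)
  | Tscale _ _ c t => Tscale c (zterm_map t)
  | Tmul _ _ _ t u => Tmul (zterm_map t) (zterm_map u)
  end.

Definition rel_map i (r : seq (presM P i * presM P (succz i))) :=
  [seq (f i p.1, f (succz i) p.2) | p <- r].

Lemma zterm_map_quad i (r : seq (presM P i * presM P (succz i))) :
  zterm_map (Tquad r) = Tquad (rel_map r).
Proof. by elim: r => //= p r ->. Qed.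

(** Asked only up to congruence, because a list representing a relation may go to a list that is a
    relation only after rewriting tensors. *)
Hypothesis rel_map0 : forall i (r : seq (presM P i * presM P (succz i))),
  presR r -> zcong (Tquad (rel_map r)) (Tzero P' i (succz (succz i))).

Lemma zterm_map_cong i j (t u : zterm P i j) :
  zcong t u -> zcong (zterm_map t) (zterm_map u).
Proof.
elim=> {i j t u} /=; try (by intros; econstructor; eauto).
- by move=> i j t; rewrite kfun1; exact: Cmul1l.
- by move=> i j t; rewrite kfun1; exact: Cmul1r.
- by move=> i a b; rewrite kfunD; exact: CconstD.
- by move=> i c; rewrite kfunk kfun1; exact: Cconstk.
- by move=> i a b; rewrite kfunM; exact: CconstM.
- by move=> i x y; rewrite sfunD; exact: CgenD.
- by move=> i a x; rewrite sfunl; exact: Cgenl.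
- by move=> i x b; rewrite sfunr; exact: Cgenr.
- by move=> i r /rel_map0; rewrite zterm_map_quad.
Qed.

Definition zquot_map i j (x : zquot P i j) : zquot P' i j :=
  zclass (zterm_map (zrepr x)).

Lemma zquot_mapE i j (t : zterm P i j) :
  zquot_map (zclass t) = zclass (zterm_map t).
Proof. exact/zclassP/zterm_map_cong/zrepr_class. Qed.

Lemma zquot_map_linear i j : linear (@zquot_map i j).
Proof.
move=> c x y; rewrite -(zreprK x) -(zreprK y) -zclassZ -zclassD.
by rewrite !zquot_mapE /= zclassD zclassZ.
Qed.

End PresentationMap.

Section PresentationIso.
Variables (k : fieldType) (P P' : zpres k).
Variable s : forall i, kalg_iso (presK P i) (presK P' i).
Variable f : forall i, bimod_siso (s i) (s (succz i)) (presM P i) (presM P' i).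

Let s' i := kalg_iso_sym (s i).
Let f' i := bimod_siso_sym (f i) : bimod_siso (s' i) (s' (succz i)) _ _.

(** The two maps are mutually inverse already on terms, so only compatibility with the congruences
    has to be checked. *)
Lemma presented_zalg_iso :
    (forall i (r : seq (presM P i * presM P (succz i))), presR r ->
       zcong (Tquad (rel_map f r)) (Tzero P' i (succz (succz i)))) ->
    (forall i (r : seq (presM P' i * presM P' (succz i))), presR r ->
       zcong (Tquad (rel_map f' r)) (Tzero P i (succz (succz i)))) ->
  zalg_isomorphic (presented_zalg P) (presented_zalg P').
Proof.
move=> fR f'R.
have fK i j (t : zterm P i j) : zterm_map f' (zterm_map f t) = t.
  elim: t => //= [i' a|i' m|i' j' t ->|i' j' t -> u ->|i' j' c t ->
    |i' j' l t -> u ->] //; first by rewrite kfunK.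
  by rewrite sfunK.
have f'K i j (t : zterm P' i j) : zterm_map f (zterm_map f' t) = t.
  elim: t => //= [i' a|i' m|i' j' t ->|i' j' t -> u ->|i' j' c t ->
    |i' j' l t -> u ->] //; first by rewrite kinvK.
  by rewrite sinvK.
pose F i j : {linear zquot P i j -> zquot P' i j} :=
  HB.pack (@zquot_map _ _ _ _ f i j) (GRing.isLinear.Build k (zquot P i j)
    (zquot P' i j) _ _ (@zquot_map_linear _ _ _ _ _ fR i j)).
exists F.
split=> [i j|i|i j l x y].
- exists (@zquot_map _ _ _ _ f' i j) => x; rewrite -[x]zreprK /= !zquot_mapE //.
    by rewrite (fK _ _ (zrepr x)); reflexivity.
  by rewrite (f'K _ _ (zrepr x)); reflexivity.
- by rewrite /= zquot_mapE //= kfun1.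
- rewrite -[x]zreprK -[y]zreprK /= qmulE !zquot_mapE // qmulE //.
Qed.

End PresentationIso.

(** * Tensor calculus in degree two *)

Section QuadraticTerms.
Variables (k : fieldType) (P : zpres k) (i : int).
Implicit Types (x : presM P i) (y : presM P (succz i)).

(** The image of the tensor of [x] and [y]. Being biadditive and balanced, it allows tensor
    computations without a tensor product. *)
Definition zquad x y : zquot P i (succz (succz i)) :=
  zclass (Tmul (Tgen x) (Tgen y)).

Lemma zclass_quad (r : seq (presM P i * presM P (succz i))) :
  zclass (Tquad r) = \sum_(p <- r) zquad p.1 p.2.
Proof.
elim: r => [|p r IHr]; first by rewrite big_nil.
by rewrite big_cons -IHr -zclassD.
Qed.

Lemma zquadDl y x x' : zquad (x + x') y = zquad x y + zquad x' y.
Proof.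
rewrite -zclassD; apply/zclassP; apply: Ctrans (CmulDl _ _ _).
by apply: Cmul; [exact: CgenD | exact: Crefl].
Qed.

Lemma zquadDr x y y' : zquad x (y + y') = zquad x y + zquad x y'.
Proof.
rewrite -zclassD; apply/zclassP; apply: Ctrans (CmulDr _ _ _).
by apply: Cmul; [exact: Crefl | exact: CgenD].
Qed.

Lemma zquadA x b y : zquad (ract x b) y = zquad x (lact b y).
Proof.
apply/zclassP.
apply: (@Ctrans _ _ _ _ _ (Tmul (Tmul (Tgen x) (Tconst b)) (Tgen y))).
  by apply: Cmul; [exact: Cgenr | exact: Crefl].
apply: Ctrans (Csym (CmulA _ _ _)) _.
by apply: Cmul; [exact: Crefl | apply/Csym/Cgenl].
Qed.

Lemma zquad_suml (I : Type) (r : seq I) (F : I -> presM P i) y :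
  zquad (\sum_(j <- r) F j) y = \sum_(j <- r) zquad (F j) y.
Proof.
apply: (big_morph _ (zquadDl y)).
by apply: (addrI (zquad 0 y)); rewrite -zquadDl !addr0.
Qed.

Lemma zquad_sumr (I : Type) (r : seq I) (F : I -> presM P (succz i)) x :
  zquad x (\sum_(j <- r) F j) = \sum_(j <- r) zquad x (F j).
Proof.
apply: (big_morph _ (zquadDr x)).
by apply: (addrI (zquad x 0)); rewrite -zquadDr !addr0.
Qed.

End QuadraticTerms.

(** * Comparison of the two algebras for a reversed helix *)

Section HelixFamily.
Variables (k : fieldType) (C : lincat k) (X : int -> C).
Hypothesis E : forall i, euler_duality (X (succz (succz i))) (X (succz i)) (X i).

Let D i := endo (X i).
Let N i : bimod (D i) (D (succz i)) := hom_bimod (X (succz i)) (X i).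
Let d i : duality (eul_Phi (E i)) (N (succz i)) (N i) := E i.

Lemma family_admissible :
    (forall i, left_findim (hom_bimod (X (succz i)) (X i)) /\
               right_findim (hom_bimod (X (succz i)) (X i))) ->
  admissible (hom_bimod (X 1) (X 0)).
Proof.
move=> fdN i; have [lfd rfd] := fdN i.
split; [move: lfd; apply: siso_left_findim | move: rfd; apply: siso_right_findim];
  exact: bimod_siso_sym (chain_iso d i).
Qed.

(** The canonical tensor does not depend on the dual bases: expanding [m'] in [dleft] and moving the
    coefficients across the composition gives the sum in [eul_dual0]. *)
Lemma dual_bases_cmp0 i n (m : 'I_n -> N i) (m' : 'I_n -> N (succz i)) :
    right_basis m ->
    (forall j l, pairing (d i) (m' j) (m l) = (j == l)%:R) ->
  \sum_j (m j : hom (X (succz i)) (X i)) \oc m' j = 0.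
Proof.
move=> m_basis mm'; rewrite -[RHS](eul_dual0 (E i)).
under eq_bigr => j _.
  rewrite {1}(dleft_expand (d i) (m' j)) cmp_sumr.
  under eq_bigr do rewrite cmpA.
  over.
rewrite exchange_big; apply: eq_bigr => l _; rewrite -cmp_suml.
by rewrite {2}(right_basis_expand m_basis mm' (dright (d i) l)).
Qed.

(** A multiple of the canonical tensor composes to zero. Conversely, a tensor that composes to zero
    is such a multiple by [eul_dual_ker], once its right factors are expanded in the basis
    [dleft]. *)
Lemma Snc_family_iso :
  zalg_isomorphic (Snc (hom_bimod (X 1) (X 0)))
    (presented_zalg (@ZPres k D N (fun i r =>
       \sum_(p <- r) (p.1 : hom (X (succz i)) (X i)) \oc p.2 = 0))).
Proof.
apply: (@presented_zalg_iso _ (ZPres _) (ZPres _) _ (chain_iso d)) => i r /=.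
  move=> [n [m [m' [a [m_basis mm' ->]]]]]; apply: Crel => /=.
  rewrite /rel_map !big_map -enumT big_enum /=.
  under eq_bigr do rewrite (sfunl (chain_iso d i)) -cmpA.
  rewrite -cmp_sumr (dual_bases_cmp0 (siso_right_basis (chain_iso d i) m_basis)).
    exact: cmpm0.
  by move=> j l; rewrite chain_iso_pair mm' kfun_nat.
move=> r0; apply/zclassP; rewrite zclass_quad big_map /=.
pose g i := sinv (chain_iso d i).
pose b := dleft (d i); pose c y l := pairing (d i) y (dright (d i) l).
(* Moving the coefficients of the right factors to the left turns the tensor [r] into the sum of the
   [z l] tensor [b l]. *)
pose z l : hom (X (succz i)) (X i) := \sum_(p <- r) p.1 \oc c p.2 l.
have {r0} /(eul_dual_ker (e := E i)) [a zE] :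
    \sum_l z l \oc b l = 0.
  apply: etrans r0; under [LHS]eq_bigr do rewrite cmp_suml.
  rewrite exchange_big; apply: eq_bigr => p _.
  rewrite [in RHS](dleft_expand (d i) p.2) cmp_sumr.
  by apply: eq_bigr => l _; rewrite cmpA.
pose P := ZPres (@unit_rel _ _ _ (N 0)); pose q := @zquad _ P i.
transitivity (\sum_l q (g i (z l)) (g (succz i) (b l))).
  under [RHS]eq_bigr do rewrite /q [g i _](sinv_sum (chain_iso d i)) zquad_suml.
  rewrite exchange_big; apply: eq_bigr => p _ /=.
  rewrite {1}(dleft_expand (d i) p.2) (sinv_sum (chain_iso d (succz i))).
  rewrite zquad_sumr.
  apply: eq_bigr => l _ /=.
  by rewrite sinvl sinvr zquadA.
(* The dual bases of [d i], pulled back along the chain, are dual for the evaluation pairing; [a']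
   is the scalar pulled back likewise. *)
pose m l := g i (dright (d i) l); pose m' l := g (succz i) (b l).
pose s := chain_scalar (fun j => eul_Phi (E j)).
pose a' := kinv (s i) (eul_Phi (E i) a).
transitivity (zclass (Tquad (P := P)
    [seq (lact a' (m l), m' l) | l <- enum 'I_(ddim (d i))])).
  rewrite zclass_quad big_map big_enum; apply: eq_bigr => l _ /=.
  by rewrite /q /g zE sinvl.
apply/zclassP; apply: Crel; exists (ddim (d i)), m, m', a'; split=> //.
  exact: (siso_right_basis (bimod_siso_sym (chain_iso d i)) (dright_basis (d i))).
move=> j l; apply: (can_inj (kfunK (s (succz i)))).
rewrite -(chain_iso_pair d) kfun_nat !sinvK; exact: pair_dual.
Qed.

End HelixFamily.

(** * Reindexing the helix and conclusion *)

(* The reindexing [f] is constrained only propositionally, so that both the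
   sequence L_{-i} and its shifts L_{c - i} are instances. *)
Lemma helix_helix_step (k : fieldType) (C : lincat k) (L : int -> C)
    (f : int -> int) : helix L -> (forall i, f i = succz (f (succz i))) ->
  forall i, helix_step (L (f (succz (succz i)))) (L (f (succz i))) (L (f i)).
Proof.
move=> hL fS i; rewrite (fS i) (fS (succz i)).
have [_ _ [E [Phi [Phik [_ bij iso]]]]] := hL (f (succz (succz i))).
by exists E, Phi, Phik.
Qed.

Theorem proposition3p6 (k : fieldType) (C : lincat k) (hC : abelian C)
    (L : int -> C) (hL : helix L) :
  (forall i : int, admissible (hom_bimod (L i) (L (succz i)))) /\
  zalg_isomorphic (Snc (hom_bimod (L (- 1)) (L 0))) (SncSeq L).
Proof.
have dualities (f : int -> int) : (forall i, f i = succz (f (succz i))) ->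
    inhabited (forall i,
      euler_duality (L (f (succz (succz i)))) (L (f (succz i))) (L (f i))).
  move=> fS; constructor=> i.
  (* Only inhabitation is known at each index, so choice is applied to obtain a family. *)
  have /cid [E _] : exists _ : euler_duality (L (f (succz (succz i))))
      (L (f (succz i))) (L (f i)), True.
    by have [E] := helix_step_duality (helix_helix_step hL fS i); exists E.
  exact: E.
have subS (c i : int) : c - i = succz (c - succz i).
  by rewrite !succzE opprD addrA subrK.
split=> [i|].
  (* For the shift c = i + 1, positions 1 and 0 of the reversed family are [L i] and
     [L (succz i)]. *)
  have [E] := dualities _ (subS (succz i)).
  have fd j : left_findim (hom_bimod (L (succz i - succz j)) (L (succz i - j))) /\
              right_findim (hom_bimod (L (succz i - succz j)) (L (succz i - j))).
    by rewrite (subS _ j); have [_] := hL (succz i - succz j).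
  have := family_admissible E fd.
  have -> : succz i - Posz 1 = i by rewrite succzE addrK.
  by rewrite subr0.
(* For the unshifted family the presentation in [Snc_family_iso] is that of [SncSeq L] by
   conversion. *)
have oppS i : - i = succz (- succz i) by rewrite !succzE opprD addrNK.
have [E] := dualities _ oppS; exact: (Snc_family_iso E).
Qed.
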